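(* In general one has $$coopF^*(X\xrightarrow{\mathrm{id}_X}X)=\delta\mathbb B^{coop}F^*(X\xrightarrow{\mathrm{id}_X}X)\subsetneqq\mathbb B^{coop}F^*(X\xrightarrow{\mathrm{id}_X}X).$$ Namely, let $F^*$ be the contravariant functor $\mathrm{Vect}$ of isomorphism classes of complex vector bundles, or the usual cohomology functor $H^*$, and let $X$ be a space. Then the equality and the strict inclusion above hold.
   Context: Spaces and continuous maps are considered. $\mathrm{Vect}(X)$ is the set of isomorphism classes of complex vector bundles on $X$, with pullback of bundles; its zero element $0$ is the class of the zero bundle. $H^*(X)$ is the usual cohomology of $X$, with zero element $0$. Both are regarded here as set-valued contravariant functors, with gradings ignored. A cohomology operation $\theta$ of a contravariant functor $F^*$ is a family of maps $\theta_X:F^*(X)\to F^*(X)$ (maps of sets, not necessarily homomorphisms), one for every space $X$, with $f^*\circ\theta_Y=\theta_X\circ f^*$ for every continuous $f:X\to Y$. Each $\theta_X$ is moreover assumed to send $0$ to $0$ (the ''zero-zero'' condition). $coopF^*$ is the set of all cohomology operations of $F^*$, and $$coopF^*(X\xrightarrow{\mathrm{id}_X}X):=\bigl\{\{\theta_{X'}:F^*(X')\to F^*(X')\mid g:X'\to X\}\bigm|\theta\in coopF^*\bigr\},$$ where each collection is indexed by all continuous maps $g$ with target $X$, and $X'$ is the source of $g$. An element of $\mathbb B^{coop}F^*(X\xrightarrow{\mathrm{id}_X}X)$ is a collection $\{c_g:F^*(X')\to F^*(X')\mid g:X'\to X\}$ of maps of sets, one for each continuous map $g$ with target $X$, such that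 $c_{g\circ h}\circ h^*=h^*\circ c_g$ for all $h:X''\to X'$ and $g:X'\to X$. The zero-zero condition is not imposed on the maps $c_g$. A map $f:X\to Y$ is sectional if it has a continuous section $s:Y\to X$, $f\circ s=\mathrm{id}_Y$. For a sectional map $f$ with a section $s$, $\delta\mathbb B^{coop}F^*(X\xrightarrow{f}Y)$ is the set of collections $\{(s')^*\circ\theta_{X'}:F^*(X')\to F^*(Y')\mid g:Y'\to Y\}$ with $\theta\in coopF^*$, where $X'=X\times_YY'$ and $s':Y'\to X'$ is the section of the projection $X'\to Y'$ induced by $s$. For a non-sectional $f$, $\delta\mathbb B^{coop}F^*(X\xrightarrow{f}Y)$ consists only of the collection of zero maps $F^*(X')\to F^*(Y')$. For $f=\mathrm{id}_X$ the section is $\mathrm{id}_X$.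
   Formalization: The strict inclusion is stated for nonempty X only: for empty X both Vect and H^* are one-point sets on every space over X, so the two sides coincide; the equality and the inclusion are stated for every space X. *)

(* Defs.v *)
From HB Require Import structures.
From mathcomp Require Import all_boot all_order all_algebra.
From mathcomp Require Import complex.
From mathcomp Require Import all_classical all_reals topology num_topology.

Set Implicit Arguments.
Unset Strict Implicit.
Unset Printing Implicit Defensive.

Import Order.TTheory GRing.Theory Num.Theory.
Import numFieldTopology.Exports.

Local Open Scope classical_set_scope.
Local Open Scope ring_scope.

Lemma sval_inj (T : Type) (P : T -> Prop) (u v : {x : T | P x}) :
  sval u = sval v -> u = v.
Proof. by case: u v => [x Px] [y Py] /= xy; exact: eq_exist. Qed.

Definition to_set (T : Type) (A : set T) (x : T) (Ax : A x) : A :=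
  exist (fun y => y \in A) x (mem_set Ax).

(* The quotient of T by r. A class is a [T -> Prop] and not a [set T], because T
   may be a large type such as that of all bundles over a space. *)
Definition classes (T : Type) (r : T -> T -> Prop) : Type :=
  {c : T -> Prop | exists x, c = r x}.

Definition class_of (T : Type) (r : T -> T -> Prop) (x : T) : classes r :=
  exist _ (r x) (ex_intro _ x erefl).

Definition class_repr (T : Type) (r : T -> T -> Prop) (c : classes r) : T :=
  sval (cid (svalP c)).

(* The map induced by [f]; it is applied only to an [f] that preserves the
   relations, in which case it is characterized by [classes_mapE]. *)
Definition classes_map (T T' : Type) (r : T -> T -> Prop)
    (r' : T' -> T' -> Prop) (f : T -> T') (c : classes r) : classes r' :=
  class_of r' (f (class_repr c)).

Definition is_equivalence (T : Type) (r : T -> T -> Prop) : Prop :=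
  [/\ forall x, r x x, forall x y, r x y -> r y x
    & forall x y z, r x y -> r y z -> r x z].

Lemma class_ofP (T : Type) (r : T -> T -> Prop) (x y : T) :
  is_equivalence r -> (class_of r x = class_of r y) <-> r x y.
Proof.
case=> rr rs rt; split=> [/(congr1 sval)/= ->//|rxy].
apply: sval_inj => /=; apply/funext => z; apply/propext.
by split=> [|/(rt _ _ _ rxy)//]; apply: rt; exact: rs.
Qed.

Lemma class_reprK (T : Type) (r : T -> T -> Prop) (c : classes r) :
  class_of r (class_repr c) = c.
Proof.
by apply: sval_inj; rewrite /class_repr; case: cid => x /= ->.
Qed.

Lemma classes_mapE (T T' : Type) (r : T -> T -> Prop) (r' : T' -> T' -> Prop)
    (f : T -> T') :
  is_equivalence r -> is_equivalence r' ->
  (forall x y, r x y -> r' (f x) (f y)) ->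
  forall x, classes_map r' f (class_of r x) = class_of r' (f x).
Proof.
move=> er er' fr x; apply/class_ofP => //; apply: fr.
by apply/class_ofP => //; rewrite class_reprK.
Qed.

Record zfunctor : Type := ZFunctor {
  zf_obj :> topologicalType -> Type;
  zf_pull : forall X Y : topologicalType,
    continuousType X Y -> zf_obj Y -> zf_obj X;
  zf_zero : forall X : topologicalType, zf_obj X;
  zf_pull_id : forall (X : topologicalType) (a : zf_obj X), zf_pull idfun a = a;
  zf_pull_comp : forall (X Y Z : topologicalType) (f : continuousType X Y)
    (g : continuousType Y Z) (a : zf_obj Z),
    zf_pull (g \o f) a = zf_pull f (zf_pull g a);
  zf_pull_zero : forall (X Y : topologicalType) (f : continuousType X Y),
    zf_pull f (zf_zero Y) = zf_zero X }.

Section FibreProduct.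
Context (X Y Y' : topologicalType).
Context (f : continuousType X Y) (g : continuousType Y' Y).

Definition fibprod_set : set (X * Y') := [set p | f p.1 = g p.2].

Definition fibprod : topologicalType := fibprod_set.

Definition fibprod_snd (p : fibprod) : Y' := (set_val p).2.

Lemma fibprod_snd_cts : continuous fibprod_snd.
Proof.
move=> p; apply: (@continuous_comp _ _ _ set_val snd); last exact: cvg_snd.
exact: initial_continuous.
Qed.

HB.instance Definition _ := @isContinuous.Build fibprod Y' fibprod_snd
  fibprod_snd_cts.

Variable s : {s : continuousType Y X | cancel s f}.

Lemma fibprod_sec_subproof (y : Y') : fibprod_set (sval s (g y), y).
Proof. by rewrite /fibprod_set/= (svalP s). Qed.

Definition fibprod_sec (y : Y') : fibprod := to_set (fibprod_sec_subproof y).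

Lemma fibprod_sec_cts : continuous fibprod_sec.
Proof.
apply: continuous_comp_initial => y.
apply: (@cvg_pair _ _ _ _ (nbhs (sval s (g y))) (nbhs y)); last exact: cvg_id.
exact: (@cts_fun _ _ (sval s \o g)).
Qed.

HB.instance Definition _ := @isContinuous.Build Y' fibprod fibprod_sec
  fibprod_sec_cts.

Lemma fibprod_secK : cancel fibprod_sec fibprod_snd.
Proof. by []. Qed.

End FibreProduct.

Section Operations.
Variable F : zfunctor.

(* Sets of families indexed by all spaces are given by predicates: the universe
   of [set] is too small for such families. *)
Definition coop (theta : forall X : topologicalType, F X -> F X) : Prop :=
  (forall (X Y : topologicalType) (f : continuousType X Y) (a : F Y),
     zf_pull f (theta Y a) = theta X (zf_pull f a)) /\
  (forall X : topologicalType, theta X (zf_zero F X) = zf_zero F X).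

(* Collections of maps F(X') -> F(X') indexed by all maps g : X' -> X. *)
Definition id_collection (X : topologicalType) : Type :=
  forall X' : topologicalType, continuousType X' X -> F X' -> F X'.

Definition coop_id (X : topologicalType) (c : id_collection X) : Prop :=
  exists theta, coop theta /\ c = (fun X' _ => theta X').

Definition Bcoop_id (X : topologicalType) (c : id_collection X) : Prop :=
  forall (X'' X' : topologicalType) (h : continuousType X'' X')
    (g : continuousType X' X) (a : F X'),
  c X'' (g \o h : continuousType X'' X) (zf_pull h a) = zf_pull h (c X' g a).

(* Collections of maps F(X') -> F(Y') indexed by all maps g : Y' -> Y, with
   X' the fibre product of f and g. *)
Definition collection (X Y : topologicalType) (f : continuousType X Y) : Type :=
  forall (Y' : topologicalType) (g : continuousType Y' Y),
    F (fibprod f g) -> F Y'.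

Definition sectional (X Y : topologicalType) (f : continuousType X Y) : Prop :=
  exists s : continuousType Y X, cancel s f.

(* The definition for a sectional map refers to a given section, hence the
   argument [sec], which is a section of f if f is sectional. *)
Definition deltaBcoop (X Y : topologicalType) (f : continuousType X Y)
    (sec : {s : continuousType Y X | cancel s f} + {~ sectional f})
    (c : collection f) : Prop :=
  match sec with
  | inleft s => exists theta, coop theta /\
      c = (fun Y' g a => zf_pull (fibprod_sec g s) (theta (fibprod f g) a))
  | inright _ => c = (fun Y' _ _ => zf_zero F Y')
  end.

(* For f = id_X the fibre product of f and g : X' -> X is homeomorphic, but not
   equal, to X'. This map turns a collection of maps
   F(X \times_X X') -> F(X') into a collection of maps F(X') -> F(X') by
   precomposition with the bijection F(X') -> F(X \times_X X') induced by the
   projection. *)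
Definition along_snd (X : topologicalType)
    (c : collection (idfun : continuousType X X)) : id_collection X :=
  fun X' g a => c X' g (zf_pull (fibprod_snd (f := idfun) (g := g)) a).

Definition id_sec (X : topologicalType) :
    {s : continuousType X X | cancel s (idfun : continuousType X X)} :=
  exist _ (idfun : continuousType X X) (fun _ => erefl).

Definition deltaBcoop_id (X : topologicalType) (d : id_collection X) : Prop :=
  exists c, deltaBcoop (inleft (id_sec X)) c /\ d = along_snd c.

Lemma along_snd_bij (X : topologicalType) : bijective (@along_snd X).
Proof.
exists (fun d Y' g a => d Y' g (zf_pull (fibprod_sec g (id_sec X)) a)).
  move=> c; apply: functional_extensionality_dep => Y'.
  apply: functional_extensionality_dep => g; apply/funext => a.
  rewrite /along_snd -zf_pull_comp -[RHS](congr1 _ (zf_pull_id a)).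
  congr (c _ _ (zf_pull _ a)); apply/continuousEP => -[[x y] /= xy].
  by apply: sval_inj; congr (_, _); exact: (esym (set_mem xy)).
move=> d; apply: functional_extensionality_dep => Y'.
apply: functional_extensionality_dep => g; apply/funext => a.
rewrite /along_snd -zf_pull_comp -[RHS](congr1 _ (zf_pull_id a)).
by congr (d _ _ (zf_pull _ a)); apply/continuousEP.
Qed.

End Operations.

Section SingularCohomology.
Variable R : realType.

Definition stdsimplex_set (n : nat) : set 'rV[R]_n.+1 :=
  [set t | (forall i, 0 <= t 0 i) /\ \sum_i t 0 i = 1].

Arguments stdsimplex_set : clear implicits.

Definition stdsimplex (n : nat) : topologicalType := stdsimplex_set n.

Definition face_fun (n : nat) (i : 'I_n.+2) (t : 'rV[R]_n.+1) : 'rV[R]_n.+2 :=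
  \row_j (if unlift i j is Some k then t 0 k else 0).

Lemma face_subproof (n : nat) (i : 'I_n.+2) (t : stdsimplex n) :
  stdsimplex_set n.+1 (face_fun i (set_val t)).
Proof.
have [t0 t1] := set_mem (svalP t); split.
  by move=> j; rewrite mxE; case: unlift.
rewrite (bigD1_ord i)//= mxE unlift_none add0r -t1.
by apply: eq_bigr => j _; rewrite mxE liftK.
Qed.

Definition face (n : nat) (i : 'I_n.+2) (t : stdsimplex n) : stdsimplex n.+1 :=
  to_set (face_subproof i t).

Lemma face_fun_cts (n : nat) (i : 'I_n.+2) : continuous (@face_fun n i).
Proof.
move=> t A [P Pt PA].
exists (fun _ k => [set x | P 0 (lift i k) x]).
  by move=> a k; have := Pt 0 (lift i k); rewrite mxE liftK (ord1 a).
move=> u uP; apply: PA => a j; rewrite (ord1 a) mxE.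
case: unliftP => [k ->|->]; first exact: (uP 0 k).
by have := Pt 0 i; rewrite mxE unlift_none => /nbhs_singleton.
Qed.

Lemma face_cts (n : nat) (i : 'I_n.+2) : continuous (@face n i).
Proof.
apply: continuous_comp_initial => t.
apply: (@continuous_comp _ _ _ set_val (@face_fun n i)).
  exact: initial_continuous.
exact: face_fun_cts.
Qed.

HB.instance Definition _ (n : nat) (i : 'I_n.+2) :=
  @isContinuous.Build (stdsimplex n) (stdsimplex n.+1) (@face n i)
    (@face_cts n i).

Definition cochain (X : topologicalType) (n : nat) : Type :=
  continuousType (stdsimplex n) X -> int.

Definition coboundary (X : topologicalType) (n : nat) (phi : cochain X n) :
    cochain X n.+1 :=
  fun s => \sum_(i < n.+2) (-1) ^+ i * phi (s \o face i).

Definition cochain_pull (X Y : topologicalType) (f : continuousType X Y)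
    (n : nat) (phi : cochain Y n) : cochain X n := fun s => phi (f \o s).

Definition is_cocycle (X : topologicalType) (n : nat) (phi : cochain X n) :
  Prop := coboundary phi = fun=> 0.

Definition is_coboundary (X : topologicalType) (n : nat) :
    cochain X n -> Prop :=
  match n with
  | 0 => fun phi => phi = fun=> 0
  | m.+1 => fun phi => exists psi : cochain X m, phi = coboundary psi
  end.

Definition cocycle (X : topologicalType) (n : nat) : Type :=
  {phi : cochain X n | is_cocycle phi}.

Definition cohomologous (X : topologicalType) (n : nat) (z z' : cocycle X n) :
  Prop := is_coboundary (fun s => sval z s - sval z' s).

Definition Hn (n : nat) (X : topologicalType) : Type :=
  classes (@cohomologous X n).

Lemma cocycle0_subproof (X : topologicalType) (n : nat) :
  is_cocycle ((fun=> 0) : cochain X n).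
Proof. by apply/funext => s; apply: big1 => i _; rewrite mulr0. Qed.

Definition Hn0 (n : nat) (X : topologicalType) : Hn n X :=
  class_of _ (exist _ _ (cocycle0_subproof X n)).

Lemma coboundary_pull (X Y : topologicalType) (f : continuousType X Y)
    (n : nat) (phi : cochain Y n) :
  coboundary (cochain_pull f phi) = cochain_pull f (coboundary phi).
Proof.
by apply/funext => s; apply: eq_bigr => i _; congr (_ * phi _);
  apply/continuousEP.
Qed.

Lemma cocycle_pull_subproof (X Y : topologicalType) (f : continuousType X Y)
    (n : nat) (z : cocycle Y n) : is_cocycle (cochain_pull f (sval z)).
Proof. by rewrite /is_cocycle coboundary_pull (svalP z). Qed.

Definition cocycle_pull (X Y : topologicalType) (f : continuousType X Y)
    (n : nat) (z : cocycle Y n) : cocycle X n :=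
  exist _ _ (cocycle_pull_subproof f z).

Definition Hn_pull (n : nat) (X Y : topologicalType) (f : continuousType X Y) :
  Hn n Y -> Hn n X := classes_map _ (@cocycle_pull X Y f n).

Lemma cohomologous_equiv (X : topologicalType) (n : nat) :
  is_equivalence (@cohomologous X n).
Proof.
split=> [x|x y|x y z]; rewrite /cohomologous.
- have -> : (fun s => sval x s - sval x s) = fun=> 0.
    by apply/funext => s; rewrite subrr.
  case: n x => [//|n] x; exists (fun=> 0).
  by rewrite (cocycle0_subproof X n).
- case: n x y => [|n] x y /=.
    move=> /(congr1 (fun f s => - f s)) xy; apply/funext => s.
    by move/(congr1 (@^~ s)): xy => /=; rewrite opprB oppr0.
  case=> psi xy; exists (fun s => - psi s).
  have -> : coboundary (fun s => - psi s) = fun s => - coboundary psi s.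
    by apply/funext => s; rewrite -sumrN; apply: eq_bigr => i _; rewrite mulrN.
  by rewrite -xy; apply/funext => s; rewrite opprB.
- case: n x y z => [|n] x y z /=.
    move=> xy yz; apply/funext => s.
    rewrite -(subrKA (sval y s) (sval x s)).
    by rewrite [X in X + _](congr1 (@^~ s) xy) [X in _ + X](congr1 (@^~ s) yz).
  case=> psi xy [psi' yz]; exists (fun s => psi s + psi' s).
  have -> : coboundary (fun s => psi s + psi' s)
            = fun s => coboundary psi s + coboundary psi' s.
    by apply/funext => s; rewrite -big_split; apply: eq_bigr => i _;
      rewrite mulrDr.
  by rewrite -xy -yz; apply/funext => s; rewrite subrKA.
Qed.

Lemma cohomologous_pull (X Y : topologicalType) (f : continuousType X Y)
    (n : nat) (z z' : cocycle Y n) :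
  cohomologous z z' -> cohomologous (cocycle_pull f z) (cocycle_pull f z').
Proof.
rewrite /cohomologous /=; case: n z z' => [|n] z z' /=.
- move=> zz'; apply/funext => s.
  exact: (congr1 (fun phi : cochain Y 0 => phi (f \o s)) zz').
- move=> [psi zz']; exists (cochain_pull f psi).
  by rewrite coboundary_pull -zz'.
Qed.

Lemma Hn_pullE (n : nat) (X Y : topologicalType) (f : continuousType X Y)
    (z : cocycle Y n) :
  Hn_pull f (class_of _ z) = class_of _ (cocycle_pull f z).
Proof.
by apply: classes_mapE; [exact: cohomologous_equiv..|
  exact: cohomologous_pull].
Qed.

Lemma Hn_pull0 (n : nat) (X Y : topologicalType) (f : continuousType X Y) :
  Hn_pull f (Hn0 n Y) = Hn0 n X.
Proof. by rewrite Hn_pullE; congr class_of; apply: sval_inj. Qed.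

(* The direct sum of the H^n(X). *)
Definition Hstar_obj (X : topologicalType) : Type :=
  {c : forall n, Hn n X | exists N, forall n, (N <= n)%N -> c n = Hn0 n X}.

Lemma Hstar_zero_subproof (X : topologicalType) :
  exists N, forall n, (N <= n)%N -> Hn0 n X = Hn0 n X.
Proof. by exists 0. Qed.

Definition Hstar_zero (X : topologicalType) : Hstar_obj X :=
  exist _ (fun n => Hn0 n X) (Hstar_zero_subproof X).

Lemma Hstar_pull_subproof (X Y : topologicalType) (f : continuousType X Y)
    (c : Hstar_obj Y) :
  exists N, forall n, (N <= n)%N -> Hn_pull f (sval c n) = Hn0 n X.
Proof. by case: c => c [N cN]; exists N => n /cN /= ->; exact: Hn_pull0. Qed.

Definition Hstar_pull (X Y : topologicalType) (f : continuousType X Y)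
    (c : Hstar_obj Y) : Hstar_obj X :=
  exist _ (fun n => Hn_pull f (sval c n)) (Hstar_pull_subproof f c).

Lemma Hstar_pull_id (X : topologicalType) (c : Hstar_obj X) :
  Hstar_pull idfun c = c.
Proof.
apply: sval_inj; apply: functional_extensionality_dep => n /=.
rewrite -{1}[sval c n]class_reprK Hn_pullE -[RHS]class_reprK; congr class_of.
apply: sval_inj; apply/funext => s /=; congr (sval _ _).
exact/continuousEP.
Qed.

Lemma Hstar_pull_comp (X Y Z : topologicalType) (f : continuousType X Y)
    (g : continuousType Y Z) (c : Hstar_obj Z) :
  Hstar_pull (g \o f) c = Hstar_pull f (Hstar_pull g c).
Proof.
apply: sval_inj; apply: functional_extensionality_dep => n /=.
rewrite -[sval c n]class_reprK !Hn_pullE; congr class_of.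
apply: sval_inj; apply/funext => s /=; congr (sval _ _).
exact/continuousEP.
Qed.

Lemma Hstar_pull_zero (X Y : topologicalType) (f : continuousType X Y) :
  Hstar_pull f (Hstar_zero Y) = Hstar_zero X.
Proof.
by apply: sval_inj; apply: functional_extensionality_dep => n; exact: Hn_pull0.
Qed.

Definition Hstar : zfunctor := ZFunctor Hstar_pull_id Hstar_pull_comp
  Hstar_pull_zero.

End SingularCohomology.

(* R[i] with the type numClosedFieldType, from which its topology is inferred *)
Definition complexes (R : realType) : numClosedFieldType := R[i].

Section VectorBundles.
Variable R : realType.
Local Notation C := (complexes R).

(* The vector space structure of the fibre over x is carried by [fib x], which
   [fib_incl] identifies with the preimage of x. In the local triviality
   condition the homeomorphism U \times C^n -> p^-1(U) is
   (y, v) |-> fib_incl (L y v), and its inverse is e |-> (p e, k e). The rank n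
   may depend on the point. As U is open, continuity on U \times C^n and on
   p^-1(U) is continuity at each of their points. *)
Record vbundle (X : topologicalType) : Type := VBundle {
  vb_total : topologicalType;
  vb_proj : continuousType vb_total X;
  fib : X -> lmodType C;
  fib_incl : forall x, fib x -> vb_total;
  fib_incl_inj : forall x, injective (@fib_incl x);
  fib_incl_range : forall x, range (@fib_incl x) = vb_proj @^-1` [set x];
  locally_trivial : forall x, exists (n : nat) (U : set X)
    (L : forall y, {linear 'rV[C]_n -> fib y}) (k : vb_total -> 'rV[C]_n),
    [/\ open U, U x,
      {in U `*` setT,
        continuous (fun q : X * 'rV[C]_n => fib_incl (L q.1 q.2))},
      {in vb_proj @^-1` U, continuous k}
    & forall y, U y -> (forall v, k (fib_incl (L y v)) = v) /\
                       (forall w, L y (k (fib_incl w)) = w)] }.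

Definition vbundle_iso (X : topologicalType) (E E' : vbundle X) : Prop :=
  exists (phi : continuousType (vb_total E) (vb_total E'))
         (psi : continuousType (vb_total E') (vb_total E)),
  [/\ cancel phi psi, cancel psi phi
    & forall x, exists L : {linear fib E x -> fib E' x},
      forall v, phi (fib_incl v) = fib_incl (L v)].

Section Trivial.
Variables (X : topologicalType) (n : nat).

Definition trivial_incl (x : X) (v : 'rV[C]_n) : X * 'rV[C]_n := (x, v).

Lemma trivial_proj_cts : continuous (@fst X 'rV[C]_n).
Proof. by move=> p; exact: cvg_fst. Qed.

Definition trivial_proj : continuousType (X * 'rV[C]_n)%type X :=
  mkcts trivial_proj_cts.

Lemma trivial_inj (x : X) : injective (trivial_incl x).
Proof. by move=> v w []. Qed.

Lemma trivial_range (x : X) :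
  range (trivial_incl x) = trivial_proj @^-1` [set x].
Proof.
apply/seteqP; split=> [_ [v _ <-]//|[y v] /= yx].
by exists v; rewrite // /trivial_incl -yx.
Qed.

Lemma trivial_loc (x : X) : exists (m : nat) (U : set X)
    (L : forall y : X, {linear 'rV[C]_m -> 'rV[C]_n})
    (k : X * 'rV[C]_n -> 'rV[C]_m),
  [/\ open U, U x,
    {in U `*` setT,
      continuous (fun q : X * 'rV[C]_m => trivial_incl q.1 (L q.1 q.2))},
    {in trivial_proj @^-1` U, continuous k}
  & forall y, U y -> (forall v, k (trivial_incl y (L y v)) = v) /\
                     (forall w, L y (k (trivial_incl y w)) = w)].
Proof.
exists n, setT, (fun _ => idfun), snd; split => //.
- exact: openT.
- move=> [y v] _.
  apply: (@cvg_pair _ _ _ _ (nbhs y) (nbhs v)); [exact: cvg_fst|exact: cvg_snd].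
- by move=> p _; exact: cvg_snd.
Qed.

Definition trivial_vb : vbundle X :=
  @VBundle X (X * 'rV[C]_n)%type trivial_proj (fun=> 'rV[C]_n) trivial_incl
    trivial_inj trivial_range trivial_loc.

End Trivial.

Section Pullback.
Variables (X Y : topologicalType) (f : continuousType X Y) (E : vbundle Y).

Definition pull_set : set (X * vb_total E) := [set p | f p.1 = vb_proj E p.2].

Definition pull_total : topologicalType := pull_set.

Lemma pull_proj_cts : continuous (fun p : pull_total => (set_val p).1).
Proof.
move=> p; apply: (@continuous_comp _ _ _ set_val fst); last exact: cvg_fst.
exact: initial_continuous.
Qed.

Definition pull_proj : continuousType pull_total X := mkcts pull_proj_cts.

Lemma vb_proj_incl (y : Y) (v : fib E y) : vb_proj E (fib_incl v) = y.
Proof.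
have : range (@fib_incl _ E y) (fib_incl v) by exists v.
by rewrite fib_incl_range.
Qed.

Lemma pull_incl_subproof (x : X) (v : fib E (f x)) : pull_set (x, fib_incl v).
Proof. by rewrite /pull_set/= vb_proj_incl. Qed.

Definition pull_incl (x : X) (v : fib E (f x)) : pull_total :=
  to_set (pull_incl_subproof v).

Lemma pull_inj (x : X) : injective (@pull_incl x).
Proof. by move=> v w [/fib_incl_inj]. Qed.

Lemma pull_range (x : X) : range (@pull_incl x) = pull_proj @^-1` [set x].
Proof.
apply/seteqP; split=> [_ [v _ <-]//|[[y e] ye] /=].
rewrite /pull_proj /mkcts /= => yx; subst y.
have : (vb_proj E @^-1` [set f x]) e by move: ye => /set_mem /= <-.
by rewrite -fib_incl_range => -[v _ ve]; exists v => //;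
  apply: val_inj; rewrite /= ve.
Qed.

Lemma pull_loc (x : X) : exists (n : nat) (U : set X)
    (L : forall y : X, {linear 'rV[C]_n -> fib E (f y)})
    (k : pull_total -> 'rV[C]_n),
  [/\ open U, U x,
    {in U `*` setT,
      continuous (fun q : X * 'rV[C]_n => pull_incl (L q.1 q.2))},
    {in pull_proj @^-1` U, continuous k}
  & forall y, U y -> (forall v, k (pull_incl (L y v)) = v) /\
                     (forall w, L y (k (pull_incl w)) = w)].
Proof.
have [n [U [L [k [oU Ufx cL ck LK]]]]] := locally_trivial E (f x).
exists n, (f @^-1` U), (fun y => L (f y)), (fun p => k (set_val p).2); split.
- by apply: open_comp => // y _; exact: cts_fun.
- exact: Ufx.
- move=> q /set_mem[Uq _] A [_ [[W oW <-]]] /= Wq /filterS; apply.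
  have : (fun q : X * 'rV[C]_n => (q.1, fib_incl (L (f q.1) q.2))) @ q --> 
         (q.1, fib_incl (L (f q.1) q.2)).
    apply: (@cvg_pair _ _ _ _ (nbhs q.1) (nbhs (fib_incl (L (f q.1) q.2)))).
      exact: cvg_fst.
    apply: (@continuous_comp _ _ _ (fun q : X * 'rV[C]_n => (f q.1, q.2))
      (fun q : Y * 'rV[C]_n => fib_incl (L q.1 q.2))).
      apply: (@cvg_pair _ _ _ _ (nbhs (f q.1)) (nbhs q.2)); last exact: cvg_snd.
      apply: (@continuous_comp _ _ _ fst f); first exact: cvg_fst.
      exact: cts_fun.
    by apply: cL; apply/mem_set.
  by apply; apply: open_nbhs_nbhs.
- move=> p /set_mem Up.
  apply: (@continuous_comp _ _ _ (fun p : pull_total => (set_val p).2) k).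
    apply: (@continuous_comp _ _ _ set_val snd); last exact: cvg_snd.
    exact: initial_continuous.
  apply: ck; apply/mem_set.
  by case: p Up => -[y e] ye; move/set_mem: (ye) => /= <-.
- by move=> y /LK[].
Qed.

Definition vbundle_pull : vbundle X :=
  @VBundle X pull_total pull_proj (fun x => fib E (f x)) pull_incl
    pull_inj pull_range pull_loc.

End Pullback.

Lemma vbundle_iso_proj (X : topologicalType) (E E' : vbundle X)
    (phi : vb_total E -> vb_total E') :
  (forall x (v : fib E x), exists w : fib E' x,
     phi (fib_incl v) = fib_incl w) ->
  forall e, vb_proj E' (phi e) = vb_proj E e.
Proof.
move=> lin e; have : (vb_proj E @^-1` [set vb_proj E e]) e by [].
rewrite -fib_incl_range => -[v _ ve]; rewrite -[in LHS]ve.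
by have [w ->] := lin _ v; rewrite vb_proj_incl.
Qed.

Lemma vbundle_iso_sym (X : topologicalType) (E E' : vbundle X) :
  vbundle_iso E E' -> vbundle_iso E' E.
Proof.
move=> [phi [psi [phiK psiK lin]]]; exists psi, phi; split=> // x.
have pp : forall e, vb_proj E' (phi e) = vb_proj E e.
  apply: vbundle_iso_proj => y v; have [L LE] := lin y.
  by exists (L v); rewrite LE.
have [L LE] := lin x.
have kex : forall w : fib E' x, exists v : fib E x,
    psi (fib_incl w) = fib_incl v.
  move=> w; have : (vb_proj E @^-1` [set x]) (psi (fib_incl w)).
    by rewrite /= -pp psiK vb_proj_incl.
  by rewrite -fib_incl_range => -[v _ <-]; exists v.
have [k kE] := choice kex.
have kK : cancel k L.
  by move=> w; apply: (@fib_incl_inj _ E' x); rewrite -LE -kE psiK.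
have LK : cancel L k.
  by move=> v; apply: (@fib_incl_inj _ E x); rewrite -kE -LE phiK.
have klin : linear k := can2_linear LK kK.
pose k' : {linear fib E' x -> fib E x} :=
  HB.pack k (GRing.isLinear.Build _ _ _ _ k klin).
by exists k'.
Qed.

Lemma vbundle_iso_equiv (X : topologicalType) :
  is_equivalence (@vbundle_iso X).
Proof.
split=> [E|E E'|E1 E2 E3].
- by exists idfun, idfun; split=> // x; exists idfun.
- exact: vbundle_iso_sym.
- move=> [phi [psi [phiK psiK lin]]] [phi' [psi' [phiK' psiK' lin']]].
  exists (phi' \o phi), (psi \o psi'); split.
  + exact: can_comp.
  + exact: can_comp.
  + move=> x; have [L LE] := lin x; have [L' LE'] := lin' x.
    by exists (L' \o L) => v /=; rewrite LE LE'.
Qed.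

Section PullbackLift.
Variables (T X Y : topologicalType) (f : continuousType X Y) (E : vbundle Y).
Variables (a : T -> X) (b : T -> vb_total E).
Hypotheses (ca : continuous a) (cb : continuous b).
Hypothesis ab : forall t, f (a t) = vb_proj E (b t).

Definition pull_lift_fun (t : T) : pull_total f E :=
  to_set (ab t : pull_set f (a t, b t)).

Lemma pull_lift_cts : continuous pull_lift_fun.
Proof.
apply: continuous_comp_initial => t.
by apply: (@cvg_pair _ _ _ _ (nbhs (a t)) (nbhs (b t))); [exact: ca|exact: cb].
Qed.

Definition pull_lift : continuousType T (pull_total f E) := mkcts pull_lift_cts.

End PullbackLift.

Section PullbackFst.
Variables (X Y : topologicalType) (f : continuousType X Y) (E : vbundle Y).

Definition pull_snd (p : pull_total f E) : vb_total E := (set_val p).2.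

Lemma pull_snd_cts : continuous pull_snd.
Proof.
move=> p; apply: (@continuous_comp _ _ _ set_val snd); last exact: cvg_snd.
exact: initial_continuous.
Qed.

Lemma pull_eqP (p q : pull_total f E) :
  pull_proj f E p = pull_proj f E q -> pull_snd p = pull_snd q -> p = q.
Proof.
move=> pq1 pq2; apply: val_inj.
by rewrite [LHS]surjective_pairing [RHS]surjective_pairing; congr (_, _).
Qed.

Lemma pull_sq (p : pull_total f E) :
  f (pull_proj f E p) = vb_proj E (pull_snd p).
Proof. exact: (set_mem (svalP p)). Qed.

End PullbackFst.

Lemma vbundle_pull_iso (X Y : topologicalType) (f : continuousType X Y)
    (E E' : vbundle Y) :
  vbundle_iso E E' -> vbundle_iso (vbundle_pull f E) (vbundle_pull f E').
Proof.
move=> EE'; have [psi0 [phi0 [_ _ lin0]]] := vbundle_iso_sym EE'.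
have [phi [psi [phiK psiK lin]]] := EE'.
have pp : forall e, vb_proj E' (phi e) = vb_proj E e.
  apply: vbundle_iso_proj => y v; have [L LE] := lin y.
  by exists (L v); rewrite LE.
have pp' : forall e, vb_proj E (psi e) = vb_proj E' e.
  by move=> e; rewrite -pp psiK.
have cphi : continuous (phi \o @pull_snd _ _ f E).
  by move=> p; apply: continuous_comp; [exact: pull_snd_cts|exact: cts_fun].
have cpsi : continuous (psi \o @pull_snd _ _ f E').
  by move=> p; apply: continuous_comp; [exact: pull_snd_cts|exact: cts_fun].
have sphi p : f (pull_proj f E p) = vb_proj E' (phi (pull_snd p)).
  by rewrite pp pull_sq.
have spsi p : f (pull_proj f E' p) = vb_proj E (psi (pull_snd p)).
  by rewrite pp' pull_sq.
exists (pull_lift (cts_fun (s := pull_proj f E)) cphi sphi).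
exists (pull_lift (cts_fun (s := pull_proj f E')) cpsi spsi).
split=> [p|p|x].
- by apply: pull_eqP => //; exact: phiK.
- by apply: pull_eqP => //; exact: psiK.
- have [L LE] := lin (f x); exists L => v.
  by apply: pull_eqP => //; exact: LE.
Qed.

Lemma vbundle_pull_id (X : topologicalType) (E : vbundle X) :
  vbundle_iso (vbundle_pull idfun E) E.
Proof.
have cid' : continuous (@idfun (vb_total E)) by move=> e; exact: cvg_id.
exists (mkcts (@pull_snd_cts _ _ idfun E)).
exists (@pull_lift _ _ _ idfun E (vb_proj E) idfun
  (cts_fun (s := vb_proj E)) cid' (fun _ => erefl)).
split=> [p|//|x]; last by exists idfun.
by apply: pull_eqP => //; exact: (esym (pull_sq p)).
Qed.

Lemma vbundle_pull_comp (X Y Z : topologicalType) (f : continuousType X Y)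
    (g : continuousType Y Z) (E : vbundle Z) :
  vbundle_iso (vbundle_pull (g \o f) E) (vbundle_pull f (vbundle_pull g E)).
Proof.
have c1 : continuous (f \o pull_proj (g \o f) E) by exact: cts_fun.
pose m : continuousType _ _ := pull_lift c1 (@pull_snd_cts _ _ (g \o f) E)
  (@pull_sq _ _ (g \o f) E).
have c2 : continuous (@pull_snd _ _ g E \o @pull_snd _ _ f (vbundle_pull g E)).
  by move=> p; apply: continuous_comp; [exact: pull_snd_cts|
    exact: pull_snd_cts].
exists (@pull_lift _ _ _ f (vbundle_pull g E) _ m
  (cts_fun (s := pull_proj (g \o f) E)) (cts_fun (s := m)) (fun _ => erefl)).
have sq (p : pull_total f (vbundle_pull g E)) :
    (g \o f) (pull_proj f _ p) = vb_proj E (pull_snd (pull_snd p)).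
  exact: (etrans (congr1 g (pull_sq p)) (@pull_sq _ _ g E (pull_snd p))).
exists (@pull_lift _ _ _ (g \o f) E _ _
  (cts_fun (s := pull_proj f (vbundle_pull g E))) c2 sq).
split=> [p|p|x].
- exact: pull_eqP.
- by apply: pull_eqP => //; apply: pull_eqP => //; exact: pull_sq.
- by exists idfun => v; apply: pull_eqP => //; apply: pull_eqP.
Qed.

Lemma vbundle_pull_trivial (X Y : topologicalType) (f : continuousType X Y)
    (n : nat) : vbundle_iso (vbundle_pull f (trivial_vb Y n)) (trivial_vb X n).
Proof.
have c1 : continuous (fun p : pull_total f (trivial_vb Y n) =>
    (pull_proj f _ p, (pull_snd p).2)).
  move=> p; apply: (@cvg_pair _ _ _ (nbhs p) (nbhs (pull_proj f _ p))
    (nbhs (pull_snd p).2)); first exact: pull_proj_cts.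
  apply: (@continuous_comp _ _ _ (@pull_snd _ _ f (trivial_vb Y n)) snd).
    exact: pull_snd_cts.
  exact: cvg_snd.
have c2 : continuous (fun p : X * 'rV[C]_n => (f p.1, p.2)).
  move=> p; apply: (@cvg_pair _ _ _ _ (nbhs (f p.1)) (nbhs p.2)).
    apply: (@continuous_comp _ _ _ fst f); first exact: cvg_fst.
    exact: cts_fun.
  exact: cvg_snd.
exists (mkcts c1).
exists (@pull_lift _ _ _ f (trivial_vb Y n) _ _ (@trivial_proj_cts X n) c2
  (fun _ => erefl)).
split=> [p|[x v]//|x].
- apply: pull_eqP => //=; rewrite /pull_snd/=.
  by rewrite [RHS]surjective_pairing; congr (_, _); exact: pull_sq.
- by exists idfun.
Qed.

Definition Vect_obj (X : topologicalType) : Type := classes (@vbundle_iso X).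

Definition Vect_zero (X : topologicalType) : Vect_obj X :=
  class_of _ (trivial_vb X 0).

Definition Vect_pull (X Y : topologicalType) (f : continuousType X Y) :
  Vect_obj Y -> Vect_obj X := classes_map _ (vbundle_pull f).

Lemma Vect_pullE (X Y : topologicalType) (f : continuousType X Y)
    (E : vbundle Y) :
  Vect_pull f (class_of _ E) = class_of _ (vbundle_pull f E).
Proof.
by apply: classes_mapE; [exact: vbundle_iso_equiv..|exact: vbundle_pull_iso].
Qed.

Lemma Vect_pull_id (X : topologicalType) (a : Vect_obj X) :
  Vect_pull idfun a = a.
Proof.
rewrite -[a]class_reprK Vect_pullE; apply/class_ofP.
  exact: vbundle_iso_equiv.
exact: vbundle_pull_id.
Qed.

Lemma Vect_pull_comp (X Y Z : topologicalType) (f : continuousType X Y)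
    (g : continuousType Y Z) (a : Vect_obj Z) :
  Vect_pull (g \o f) a = Vect_pull f (Vect_pull g a).
Proof.
rewrite -[a]class_reprK !Vect_pullE; apply/class_ofP.
  exact: vbundle_iso_equiv.
exact: vbundle_pull_comp.
Qed.

Lemma Vect_pull_zero (X Y : topologicalType) (f : continuousType X Y) :
  Vect_pull f (Vect_zero Y) = Vect_zero X.
Proof.
rewrite Vect_pullE; apply/class_ofP; first exact: vbundle_iso_equiv.
exact: vbundle_pull_trivial.
Qed.

Definition Vect : zfunctor := ZFunctor Vect_pull_id Vect_pull_comp
  Vect_pull_zero.

End VectorBundles.

(* Main.v *)
Require Import Defs.
From mathcomp Require Import all_boot all_order all_algebra.
From mathcomp Require Import all_classical all_reals topology.

(** The fibre product of the identity of [X] with [g : X' -> X] projects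
homeomorphically onto [X'], with inverse the induced section, so naturality of
an operation [theta] along this projection turns the collection defined from
the fibre products back into [theta] itself; this is the equality
([deltaBcoop_idE]).  Such a collection is compatible with all pullbacks because
[theta] is natural.

The inclusion is strict as soon as [F X] has an element [u] other than zero:
the collection of constant maps with value [g^* u], for [g : X' -> X], is
compatible with pullbacks by functoriality, but at the identity of [X] it sends
zero to [u], which no operation does ([constant_collection_notin_delta]).  For a
nonempty [X] such an element is the class of the trivial line bundle, whose
fibre is not isomorphic to that of the zero bundle, or the unit of degree-zero
cohomology, which takes the value 1 on every singular 0-simplex. *)

Set Implicit Arguments.
Unset Strict Implicit.
Unset Printing Implicit Defensive.

Import GRing.Theory.
Local Open Scope ring_scope.

(** * Collections induced by operations *)

Section Collections.
Variables (F : zfunctor) (X : topologicalType).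

Lemma fibprod_sec_snd_pull (X' : topologicalType) (g : continuousType X' X)
    (a : F X') :
  zf_pull (fibprod_sec g (id_sec X))
    (zf_pull (fibprod_snd (f := idfun) (g := g)) a) = a.
Proof.
rewrite -zf_pull_comp -[RHS]zf_pull_id.
by congr (zf_pull _ a); apply/continuousEP.
Qed.

(** Naturality of [theta] moves it past the pullback along the projection, which
then cancels against the pullback along the section. *)
Lemma along_snd_coop (theta : forall X : topologicalType, F X -> F X) :
  coop theta ->
  along_snd (fun X' (g : continuousType X' X) a =>
    zf_pull (fibprod_sec g (id_sec X)) (theta (fibprod idfun g) a))
  = (fun X' _ => theta X').
Proof.
move=> [nat_theta _]; apply: functional_extensionality_dep => X'.
apply: functional_extensionality_dep => g; apply/funext => a.
by rewrite /along_snd -nat_theta fibprod_sec_snd_pull.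
Qed.

Lemma deltaBcoop_idE (c : id_collection F X) : coop_id c <-> deltaBcoop_id c.
Proof.
split=> [[theta [coop_theta ->]]|[_ [[theta [coop_theta ->]] ->]]].
  eexists; split; last exact: (esym (along_snd_coop coop_theta)).
  by exists theta.
by exists theta; split; last exact: along_snd_coop.
Qed.

Lemma coop_id_Bcoop (c : id_collection F X) : coop_id c -> Bcoop_id c.
Proof. by move=> [theta [[nat_theta _] ->]] X'' X' h g a; rewrite nat_theta. Qed.

Definition constant_collection (u : F X) : id_collection F X :=
  fun _ g _ => zf_pull g u.

Lemma constant_collection_Bcoop (u : F X) : Bcoop_id (constant_collection u).
Proof. by move=> X'' X' h g a; exact: zf_pull_comp. Qed.

(** At the identity of [X] the zero-zero condition reads [u = 0]. *)
Lemma constant_collection_notin_delta (u : F X) :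
  u <> zf_zero F X -> ~ deltaBcoop_id (constant_collection u).
Proof.
move=> u_neq0 /deltaBcoop_idE[theta [[_ theta0] cE]]; apply: u_neq0.
rewrite -(theta0 X) -[LHS]zf_pull_id.
exact: (congr1 (fun c : id_collection F X => c X idfun (zf_zero F X)) cE).
Qed.

End Collections.

(** * Nonzero elements of Vect(X) and of the cohomology of X *)

(** An isomorphism would restrict on a fibre to an injection of a line into the
zero space. *)
Lemma trivial_line_neq0 (R : realType) (X : topologicalType) (x : X) :
  class_of (@vbundle_iso R X) (trivial_vb R X 1) <> Vect_zero R X.
Proof.
move=> /(class_ofP _ _ (@vbundle_iso_equiv R X))[phi [psi [phiK _ lin]]].
have [L LE] := lin x.
have fib0 (v w : fib (trivial_vb R X 0) x) : v = w.
  exact: etrans (thinmx0 v) (esym (thinmx0 w)).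
have phi10 : phi (x, const_mx 1) = phi (x, 0).
  by rewrite (LE (const_mx 1)) (LE 0) (fib0 (L (const_mx 1)) (L 0)).
have [/rowP/(_ ord0)] := can_inj phiK phi10.
by rewrite !mxE => /eqP; rewrite oner_eq0.
Qed.

Section CohomologyUnit.
Variables (R : realType) (X : topologicalType).

Lemma unit_cocycle_subproof : is_cocycle ((fun=> 1) : cochain R X 0).
Proof. by apply/funext => s; rewrite /coboundary !big_ord_recl big_ord0. Qed.

Definition H0_unit : Hn R 0 X := class_of _ (exist _ _ unit_cocycle_subproof).

Definition Hstar_unit_fun (n : nat) : Hn R n X :=
  if n is 0 then H0_unit else Hn0 R _ X.

Lemma Hstar_unit_subproof :
  exists N, forall n, (N <= n)%N -> Hstar_unit_fun n = Hn0 R n X.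
Proof. by exists 1 => -[]. Qed.

Definition Hstar_unit : Hstar R X := exist _ _ Hstar_unit_subproof.

(** The only coboundary in degree 0 is zero, and the constant 0-simplex at [x]
distinguishes it from the unit cocycle. *)
Lemma Hstar_unit_neq0 (x : X) : Hstar_unit <> zf_zero (Hstar R) X.
Proof.
move=> /(congr1 (fun c => sval c 0)) /=.
move=> /(class_ofP _ _ (@cohomologous_equiv R X 0)).
have cst_cts : continuous (fun _ : stdsimplex R 0 => x).
  exact: cst_continuous.
by move=> /(congr1 (fun phi : cochain R X 0 => phi (mkcts cst_cts))).
Qed.

End CohomologyUnit.

(** * Equality and strict inclusion *)

Theorem mainTheorem3 (R : realType) (F : zfunctor)
    (hF : F = Vect R \/ F = Hstar R) (X : topologicalType) :
  (forall c : id_collection F X, coop_id c <-> deltaBcoop_id c) /\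
  (forall c : id_collection F X, deltaBcoop_id c -> Bcoop_id c) /\
  (inhabited X ->
   exists c : id_collection F X, Bcoop_id c /\ ~ deltaBcoop_id c).
Proof.
split; [exact: deltaBcoop_idE|split=> [c /deltaBcoop_idE|[x]]].
  exact: coop_id_Bcoop.
have [u u_neq0] : exists u : F X, u <> zf_zero F X.
  case: hF => ->; first by eexists; exact: (trivial_line_neq0 x).
  by exists (Hstar_unit R X); exact: (Hstar_unit_neq0 x).
exists (constant_collection u); split; first exact: constant_collection_Bcoop.
exact: constant_collection_notin_delta.
Qed.
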